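(* Let $L$ be a compactly generated multiplicative lattice with $1$ compact, let $\Sigma_L$ be a class of elements of $L$, and let $\mathrm{Max}(\Sigma_L)$ denote the set of maximal elements of $\Sigma_L$ (with respect to $\leqslant$). Then the following are equivalent: (1) the lower space $\Sigma_L$ is compact; (2) for every $x\in\Sigma_L$ there exists $m\in\mathrm{Max}(\Sigma_L)$ such that $x\leqslant m$, and $\mathrm{Max}(\Sigma_L)$ is compact.
   Context: A multiplicative lattice is a complete lattice $(L,\leqslant,0,1)$ with a binary operation $\cdot$ that is associative, commutative, satisfies $x\cdot 1=x$, and satisfies $x\cdot\bigvee_{\lambda\in\Lambda}y_\lambda=\bigvee_{\lambda\in\Lambda}(x\cdot y_\lambda)$ for all $x\in L$ and all families $(y_\lambda)_{\lambda\in\Lambda}$ in $L$. $x^n$ is the $n$-fold product. Element $x$ is proper if $x\neq 1$. A proper $p$ is prime if $x\cdot y\leqslant p$ implies $x\leqslant p$ or $y\leqslant p$; a prime $p$ is minimal prime if there is no prime $q\neq p$ with $q\leqslant p$. A proper $m$ is a maximal element of $L$ if $m\leqslant n$ and $n\neq 1$ imply $m=n$. An element $c$ is compact if $c\leqslant\bigvee_{\lambda\in\Lambda}x_\lambda$ implies $c\leqslant\bigvee_{i=1}^n x_{\lambda_i}$ for some finite subfamily. $x$ is idempotent if $x\cdot x=x$, nilpotent if $x^n=0$ for some $n\geq 1$. The radical of $x$ is $\sqrt{x}=\bigvee\{y\in L\mid y \text{ compact},\ y^n\leqslant x \text{ for some } n\geq 1\}=\bigwedge\{p \text{ prime}\mid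 x\leqslant p\}$ (the two expressions are taken to agree); $r$ is a radical element if $r=\sqrt r$. $q$ is primary if $x\cdot y\leqslant q$ implies $x\leqslant q$ or $y\leqslant\sqrt q$. $s$ is strongly irreducible if $x\wedge y\leqslant s$ implies $x\leqslant s$ or $y\leqslant s$; irreducible if $x\wedge y=s$ implies $x=s$ or $y=s$; completely irreducible if $s=\bigwedge_{\lambda\in\Lambda}x_\lambda$ implies $s=x_\lambda$ for some $\lambda$. A class $\Sigma_L$ of elements of $L$ is any one of the sets of: proper, prime, minimal prime, maximal, compact, idempotent, nilpotent, radical, primary, strongly irreducible, irreducible, completely irreducible elements of $L$. For $x\in L$ put $v(x)=\{l\in\Sigma_L\mid x\leqslant l\}$. The lower space $\Sigma_L$ is the set $\Sigma_L$ with the lower topology, i.e. the topology for which $\{v(x)\mid x\in L\}$ is a subbasis of closed sets. $L$ is compactly generated if every element is a join of compact elements. $\mathrm{Max}(\Sigma_L)$ carries the subspace topology from $\Sigma_L$. Compactness of a space means every open cover has a finite subcover (no separation axiom). *)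

(* Defs.v *)
From HB Require Import structures.
From mathcomp Require Import all_boot all_order.
From mathcomp Require Import all_classical.
From mathcomp Require Import topology.

Set Implicit Arguments.
Unset Strict Implicit.
Unset Printing Implicit Defensive.

Import Order.TTheory.
Local Open Scope classical_set_scope.
Local Open Scope order_scope.

HB.mixin Record TBLattice_isComplete d L & Order.TBLattice d L := {
  supremums_neq0 : forall A : set L, supremums A !=set0;
  infimums_neq0 : forall A : set L, infimums A !=set0
}.

#[short(type="completeLatticeType")]
HB.structure Definition CompleteLattice d :=
  {L of Order.TBLattice d L & TBLattice_isComplete d L}.

Definition bigjoin d (L : completeLatticeType d) (A : set L) : L :=
  supremum \bot A.

Definition bigmeet d (L : completeLatticeType d) (A : set L) : L :=
  infimum \top A.

Lemma bigjoin_supremums d (L : completeLatticeType d) (A : set L) :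
  supremums A (bigjoin A).
Proof.
rewrite /bigjoin /supremum; case: ifPn => [/eqP ->|_].
  by split=> [y []|y _]; exact: le0x.
by case: xgetP => // /(_ _) nA; have [s /nA] := supremums_neq0 A.
Qed.

Lemma bigmeet_infimums d (L : completeLatticeType d) (A : set L) :
  infimums A (bigmeet A).
Proof.
rewrite /bigmeet /infimum; case: ifPn => [/eqP ->|_].
  by split=> [y []|y _]; exact: lex1.
by case: xgetP => // /(_ _) nA; have [s /nA] := infimums_neq0 A.
Qed.

(* The product, its unit and its powers are those of [monoidType], i.e.
   [x * y], [1] and [x ^+ n] in [group_scope]. *)
HB.mixin Record isMultLattice d L & CompleteLattice d L & Monoid L := {
  multl_comm : commutative (@mul L);
  multl_one : 1%g = \top :> L;
  multl_bigjoin : forall (x : L) (A : set L),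
    (x * bigjoin A)%g = bigjoin [set (x * y)%g | y in A]
}.

#[short(type="multLatticeType")]
HB.structure Definition MultLattice d :=
  {L of CompleteLattice d L & Monoid L & isMultLattice d L}.

Section Elements.
Context {d : Order.disp_t} {L : multLatticeType d}.
Implicit Types (x y c p m q r s : L) (A F Sigma : set L).

Definition proper_elt x : Prop := x <> \top.

Definition prime_elt p : Prop :=
  proper_elt p /\ forall x y, (x * y)%g <= p -> x <= p \/ y <= p.

Definition minimal_prime_elt p : Prop :=
  prime_elt p /\ ~ exists q, [/\ prime_elt q, q <> p & q <= p].

Definition maximal_elt m : Prop :=
  proper_elt m /\ forall n : L, m <= n -> n <> \top -> m = n.

Definition compact_elt c : Prop :=
  forall A, c <= bigjoin A ->
    exists F, [/\ finite_set F, F `<=` A & c <= bigjoin F].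

Definition idempotent_elt x : Prop := (x * x)%g = x.

Definition nilpotent_elt x : Prop :=
  exists n : nat, (1 <= n)%N /\ (x ^+ n)%g = \bot.

(* The other usual expression of the radical, the meet of the primes above [x],
   lies above this join; they agree e.g. when [L] is compactly generated and
   its compact elements are closed under product. *)
Definition radical x : L :=
  bigjoin [set y | compact_elt y /\
                   exists n : nat, (1 <= n)%N /\ (y ^+ n)%g <= x].

Definition radical_elt r : Prop := r = radical r.

(* Properness is not part of the next three notions. *)
Definition primary_elt q : Prop :=
  forall x y, (x * y)%g <= q -> x <= q \/ y <= radical q.

Definition strongly_irreducible_elt s : Prop :=
  forall x y, x `&` y <= s -> x <= s \/ y <= s.

Definition irreducible_elt s : Prop :=
  forall x y, x `&` y = s -> x = s \/ y = s.

(* The empty family is allowed, so [\top] is not completely irreducible. *)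
Definition completely_irreducible_elt s : Prop :=
  forall A, s = bigmeet A -> A s.

Inductive element_class : set L -> Prop :=
| ProperClass : element_class proper_elt
| PrimeClass : element_class prime_elt
| MinimalPrimeClass : element_class minimal_prime_elt
| MaximalClass : element_class maximal_elt
| CompactClass : element_class compact_elt
| IdempotentClass : element_class idempotent_elt
| NilpotentClass : element_class nilpotent_elt
| RadicalClass : element_class radical_elt
| PrimaryClass : element_class primary_elt
| StronglyIrreducibleClass : element_class strongly_irreducible_elt
| IrreducibleClass : element_class irreducible_elt
| CompletelyIrreducibleClass : element_class completely_irreducible_elt.

End Elements.

Definition compactly_generated d (L : multLatticeType d) : Prop :=
  forall x : L, exists A : set L, A `<=` compact_elt /\ x = bigjoin A.

Definition lower_space d (L : multLatticeType d) (Sigma : set L) : Type :=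
  {x : L | x \in Sigma}.

HB.instance Definition _ d (L : multLatticeType d) (Sigma : set L) :=
  Choice.on (lower_space Sigma).

Definition lower_v d (L : multLatticeType d) (Sigma : set L) (x : L) :
    set (lower_space Sigma) :=
  [set l | x <= val l].

Arguments lower_v {d L} Sigma x.

(* The subbasic open sets are the complements of the sets [lower_v x]. *)
HB.instance Definition _ d (L : multLatticeType d) (Sigma : set L) :=
  isSubBaseTopological.Build (lower_space Sigma)
    (range (lower_v Sigma)) (@setC (lower_space Sigma)).

Definition Max d (L : multLatticeType d) (Sigma : set L) :
    set (lower_space Sigma) :=
  [set m | forall n : lower_space Sigma, val m <= val n -> m = n].

Arguments Max {d L} Sigma.

Definition subspace_on (T : topologicalType) (A : set T) : topologicalType :=
  initial_topology (fun a : A => val a).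

Definition compact_space (T : topologicalType) : Prop :=
  cover_compact [set: T].

(* Main.v *)
(** Open sets of the lower topology are down-sets, being unions of finite
    intersections of complements of sets [v x].  Hence, as soon as every element
    of [Sigma] lies below a maximal one, an open family covers [Sigma] iff it
    covers [Max Sigma].  If [Sigma] is compact then every chain in [Sigma] is
    bounded above in [Sigma] (otherwise the complements of the [v c], for [c] in
    the chain, would be an open cover without a finite subcover), and Zorn's
    lemma provides the maximal elements. *)
Require Import Defs.
From mathcomp Require Import all_boot all_order.
From mathcomp Require Import all_classical.
From mathcomp Require Import topology.

Set Implicit Arguments.
Unset Strict Implicit.
Unset Printing Implicit Defensive.

Import Order.TTheory.
Local Open Scope classical_set_scope.
Local Open Scope order_scope.

Lemma compact_subspace_onE (T : topologicalType) (A : set T) :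
  compact_space (subspace_on A) <-> cover_compact A.
Proof.
split=> [cA|cA] I D f fop fcov.
- have [i Di|[a aA] _|D' sD cD'] := cA I D (fun i => val @^-1` f i).
  + by exists (f i) => //; exact: fop.
  + by have [i Di fia] := fcov a (set_mem aA); exists i.
  + exists D' => // a Aa.
    by have [i D'i fia] := cD' (SigSub (mem_set Aa)) Logic.I; exists i.
- have /choice[g gP] : forall i, exists U : set T,
      D i -> open U /\ val @^-1` U = f i.
    (* Outside [D] the value [setT] is arbitrary. *)
    move=> i; have [Di|nDi] := pselect (D i); last by exists setT.
    by have [U oU UE] := fop i Di; exists U.
  have [i /gP[]//|a Aa|D' sD cD'] := cA I D g.
    have [i Di fia] := fcov (SigSub (mem_set Aa)) Logic.I.
    by exists i => //; move: fia; rewrite -(gP i Di).2.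
  exists D' => // a _; have [i D'i gia] := cD' (val a) (set_mem (valP a)).
  by exists i => //; rewrite -(gP i (set_mem (sD i D'i))).2.
Qed.

Section LowerSpace.
Context {d : Order.disp_t} {L : multLatticeType d} {Sigma : set L}.
Implicit Types (x y : lower_space Sigma) (A U : set (lower_space Sigma)).

Lemma open_lowerE U : open U =
  exists2 B, B `<=` finI_from (range (lower_v Sigma)) setC &
             \bigcup_(V in B) V = U.
Proof. by []. Qed.

Lemma open_lower_downset U x y : open U -> val x <= val y -> U y -> U x.
Proof.
rewrite open_lowerE => -[B BI <-] xy [V BV Vy]; exists V => //.
have [F sF FV] := BI V BV; move: Vy; rewrite -FV => Vy C FC Cx.
(* [C] is some [v z], an up-set: if it contained [x], it would contain [y]. *)
have /set_mem[z _ zC] := sF C FC.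
by apply: (Vy C FC); move: Cx; rewrite -zC => /le_trans; apply.
Qed.

Lemma open_setC_lower_v (z : L) : open (~` lower_v Sigma z).
Proof.
rewrite open_lowerE; exists [set ~` lower_v Sigma z]; last by rewrite bigcup_set1.
by move=> _ ->; apply: finI_from1; exists z.
Qed.

(** Induction keeps the larger of two comparable elements, so the bound stays inside the chain; a
    point of [A] serves for the empty sequence. *)
Lemma chain_seq_ub A (s : seq (lower_space Sigma)) : A !=set0 ->
  total_on A (fun x y => val x <= val y) -> {in s, forall x, A x} ->
  exists2 m, A m & {in s, forall x, val x <= val m}.
Proof.
move=> [a Aa] totA; elim: s => [_|x s ih sA]; first by exists a.
have [|m Am sm] := ih; first by move=> y ys; apply: sA; rewrite inE ys orbT.
have Ax : A x by apply: sA; rewrite mem_head.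
have [xm|mx] := totA x m Ax Am.
  by exists m => // y; rewrite inE => /predU1P[->//|/sm].
exists x => // y; rewrite inE => /predU1P[->//|/sm ym]; exact: le_trans mx.
Qed.

Lemma compact_chain_ub A : compact_space (lower_space Sigma) ->
  A !=set0 -> total_on A (fun x y => val x <= val y) ->
  exists y, forall x, A x -> val x <= val y.
Proof.
move=> cS A0 totA; apply: contrapT => /forallNP nub.
have [x _|y _|F sF cF] := cS _ A (fun x => ~` lower_v Sigma (val x)).
- exact: open_setC_lower_v.
- by have /existsNP[x /not_implyP[Ax xy]] := nub y; exists x.
(* The bound [m] lies in [v x] for every [x] in [F], so the finite subfamily misses it. *)
have [|m Am Fm] := @chain_seq_ub A (finmap.enum_fset F) A0 totA; first by move=> x /sF/set_mem.
by have [x Fx] := cF m Logic.I; apply; exact: Fm.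
Qed.

Lemma compact_le_Max x : compact_space (lower_space Sigma) ->
  exists m, Max Sigma m /\ val x <= val m.
Proof.
(* Zorn is applied above [x] only; whatever lies above a maximal element of [T] is again in [T], so
   maximality passes to [Sigma]. *)
move=> cS; pose T := {y : lower_space Sigma | val x <= val y}.
have [t|r s t|s t st ts|A totA|m mmax] :=
  @Zorn T (fun s t => val (val s) <= val (val t)).
- exact: lexx.
- exact: le_trans.
- by do 2!apply: val_inj; apply: le_anti; rewrite st ts.
(* The empty chain is bounded by [x] itself. *)
- have [->|/set0P[a Aa]] := eqVneq A set0; first by exists (Sub x (lexx _)).
  have [||y yub] := @compact_chain_ub (val @` A) cS.
  + by exists (val a), a.
  + by move=> _ _ [s As <-] [t At <-]; exact: totA.
  have xy : val x <= val y by apply: le_trans (valP a) (yub _ _); exists a.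
  by exists (Sub y xy) => s As; apply: yub; exists s.
exists (val m); split; last exact: valP m.
move=> n mn; have xn : val x <= val n by apply: le_trans (valP m) mn.
by rewrite -(mmax (Sub n xn)).
Qed.

Lemma cover_MaxE (I : Type) (D : set I) (f : I -> set (lower_space Sigma)) :
  (forall x, exists m, Max Sigma m /\ val x <= val m) ->
  (forall i, D i -> open (f i)) ->
  (Max Sigma `<=` cover D f) = ([set: lower_space Sigma] `<=` cover D f).
Proof.
move=> ubM fop; apply/propext; split=> [cM x _|cS x _]; last exact: cS.
have [m [Mm xm]] := ubM x; have [i Di fim] := cM m Mm.
by exists i => //; exact: open_lower_downset (fop i Di) xm fim.
Qed.

(** [cover_MaxE] is used twice in each direction: on the given family and on the finite subfamily
    extracted from it. *)
Lemma cover_compact_MaxE :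
  (forall x, exists m, Max Sigma m /\ val x <= val m) ->
  cover_compact (Max Sigma) <-> compact_space (lower_space Sigma).
Proof.
move=> ubM; split=> cT I D f fop fcov.
- have [|F sF cF] := cT I D f fop; first by rewrite cover_MaxE.
  by exists F => //; rewrite -cover_MaxE// => i /sF/set_mem/fop.
- have [|F sF cF] := cT I D f fop; first by rewrite -cover_MaxE.
  by exists F => //; rewrite cover_MaxE// => i /sF/set_mem/fop.
Qed.

End LowerSpace.

Theorem proposition2p9 (d : Order.disp_t) (L : multLatticeType d)
    (L_cg : compactly_generated L) (one_compact : compact_elt (\top : L))
    (Sigma : set L) (Sigma_class : element_class Sigma) :
  compact_space (lower_space Sigma) <->
  (forall x : lower_space Sigma, exists m : lower_space Sigma,
     Max Sigma m /\ val x <= val m) /\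
  compact_space (subspace_on (Max Sigma)).
Proof.
rewrite compact_subspace_onE; split=> [cS|[ubM cM]].
  have ubM x := compact_le_Max x cS.
  by split=> //; apply/cover_compact_MaxE.
exact/cover_compact_MaxE.
Qed.
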